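(* Let $k,\ell\ge 0$ be integers, not both zero. Let $P_i$ ($1\le i\le k$) and $Q_j$ ($1\le j\le\ell$) be L-bounded posets with large intervals $I_i$ and $I'_j$, respectively. Further, assume each $P_i$ has a $\hat 0$ and each $Q_j$ has a $\hat 1$. (If $k=0$ or $\ell=0$, the corresponding collection is empty.) Then the poset $$R:=Q_1\oplus_I\cdots\oplus_I Q_\ell\oplus_I P_1\oplus_I\cdots\oplus_I P_k$$ is L-bounded.
   Context: All posets are finite and nonempty. Let $[n]=\{1,\dots,n\}$; families of subsets of $[n]$ are ordered by inclusion. A poset $(P,\le)$ contains a poset $(P',\le')$ as a (weak) subposet if there is an injection $f:P'\to P$ such that $u\le' v$ implies $f(u)\le f(v)$. A family $\mathcal F\subseteq 2^{[n]}$ is $P$-free if it does not contain $P$ in this sense. $e(P)$ is the maximum integer $k\ge 0$ such that for all integers $n$ and $s$ the family $\binom{[n]}{s}\cup\binom{[n]}{s+1}\cup\cdots\cup\binom{[n]}{s+k-1}$ is $P$-free, where $\binom{[n]}{j}$ is the collection of $j$-element subsets of $[n]$ (empty if $j<0$ or $j>n$). The Lubell function of $\mathcal F\subseteq 2^{[n]}$ is the average over all $n!$ full (maximal) chains $\mathcal C$ of $2^{[n]}$ of $|\mathcal F\cap\mathcal C|$; equivalently $\bar h_n(\mathcal F)=\sum_{F\in\mathcal F}1/\binom{n}{|F|}$. For an integer $m\ge0$, $P$ is $m$-L-bounded if for all $n$, $\bar h_n(\mathcal F)\le e(P)$ for every $P$-free family $\mathcal F$ of subsets of $[n]$ all of whose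 members have sizes in $[m,n-m]$. $P$ is L-bounded if it is $m$-L-bounded for some integer $m\ge 0$. An element $x$ of a poset $P$ is $\hat 0$ (resp. $\hat 1$) if $x\le p$ (resp. $x\ge p$) for all $p\in P$. For $a\le b$ in $P$, the interval $[a,b]$ is the subposet $\{c\in P: a\le c\le b\}$. A large interval of $P$ is a maximal (under inclusion) interval $I$ of $P$ with $e(I)=e(P)$. Given posets $S_1,\dots,S_r$ with chosen large intervals $J_1,\dots,J_r$, $S_1\oplus_I S_2\oplus_I\cdots\oplus_I S_r$ denotes the poset obtained from the disjoint union of the $S_i$ by identifying, for $1\le i\le r-1$, the maximal element of $J_i$ with the minimal element of $J_{i+1}$, the order being the transitive closure of the union of the orders of the $S_i$. (An L-bounded poset has at most one large interval, so here the operation does not depend on choices.) *)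

(* Defs.v *)
From HB Require Import structures.
From mathcomp Require Import all_boot all_order all_algebra all_fingroup.
From mathcomp Require Import boolp.

Set Implicit Arguments.
Unset Strict Implicit.
Unset Printing Implicit Defensive.

Import Order.TTheory GRing.Theory Num.Theory.

(* Finite posets are [finPOrderType d]; the empty one is not excluded by the
   type, but every poset in the main statement has an element. *)

(* Weak containment: only [u <= v -> f u <= f v] is required of [f]. *)
Definition contains (d : Order.disp_t) (P : finPOrderType d) (n : nat)
    (F : {set {set 'I_n}}) : Prop :=
  exists f : P -> {set 'I_n},
    [/\ injective f, forall u, f u \in F
      & forall u v, (u <= v)%O -> f u \subset f v].

Definition pfree (d : Order.disp_t) (P : finPOrderType d) (n : nat)
    (F : {set {set 'I_n}}) : Prop := ~ contains P F.

Definition levels (n k : nat) (s : int) : {set {set 'I_n}} :=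
  [set A : {set 'I_n} | (s <= Posz #|A|)%R && (Posz #|A| < s + Posz k)%R].

Definition levels_free (d : Order.disp_t) (P : finPOrderType d) (k : nat)
    : Prop :=
  forall (n : nat) (s : int), pfree P (levels n k s).

(* The search for the maximum is cut at [k <= #|P|] to make [e] total; this
   loses nothing by [levels_free_bound], see [e_max]. *)
Definition e (d : Order.disp_t) (P : finPOrderType d) : nat :=
  \max_(k < #|P|.+1 | `[< levels_free P k >]) k.

Lemma levels_free0 (d : Order.disp_t) (P : finPOrderType d) :
  0 < #|P| -> levels_free P 0.
Proof.
move=> /card_gt0P[x _] n s [f [_ /(_ x) + _]].
by rewrite inE addr0 => /andP[le_s /(le_lt_trans le_s)]; rewrite ltxx.
Qed.

Lemma levels_free_bound (d : Order.disp_t) (P : finPOrderType d) (k : nat) :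
  levels_free P k -> k <= #|P|.
Proof.
move=> fk; rewrite leqNgt; apply/negP => ltk; apply: (fk #|P| 0%R).
pose D (x : P) := [set enum_rank y | y in [pred y : P | (y <= x)%O]].
have inD x y : (enum_rank y \in D x) = (y <= x)%O.
  by rewrite mem_imset //; apply: enum_rank_inj.
exists D; split=> [x y Dxy|x|x y xy].
- apply: le_anti; have := inD x x; have := inD y y.
  by rewrite {1}Dxy -{1}Dxy !inD !lexx => -> ->.
- rewrite inE /= add0r ltz_nat (leq_ltn_trans _ ltk) //.
  by rewrite -[leqRHS]card_ord max_card.
- by apply/subsetP=> _ /imsetP[z zx ->]; rewrite inD (le_trans _ xy).
Qed.

Lemma e_max (d : Order.disp_t) (P : finPOrderType d) : 0 < #|P| ->
  levels_free P (e P) /\ forall k, levels_free P k -> k <= e P.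
Proof.
move=> P0; split; last first.
  move=> k fk; have ltk : k < #|P|.+1 by rewrite ltnS levels_free_bound.
  by apply: (leq_bigmax_cond (Ordinal ltk)); apply/asboolP.
rewrite /e; elim/big_ind: _ => [|x y fx fy|i /asboolP //].
  exact: levels_free0.
by rewrite /maxn; case: ifP.
Qed.

Section Lubell.
Variable n : nat.

Definition is_chain (C : {set {set 'I_n}}) : bool :=
  [forall A in C, forall B in C, (A \subset B) || (B \subset A)].

Definition full_chains : {set {set {set 'I_n}}} :=
  [set C | maxset is_chain C].

Definition lubell (F : {set {set 'I_n}}) : rat :=
  ((\sum_(C in full_chains) #|F :&: C|%:R) / #|full_chains|%:R)%R.

Lemma is_chainP (C : {set {set 'I_n}}) :
  reflect {in C &, forall A B : {set 'I_n}, (A \subset B) || (B \subset A)} (is_chain C).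
Proof.
apply: (iffP forall_inP) => [h A B inA inB|h A inA].
  by have /forall_inP := h A inA; apply.
by apply/forall_inP => B inB; apply: h.
Qed.

Lemma is_chainU1 (C : {set {set 'I_n}}) (Z : {set 'I_n}) :
  is_chain C -> {in C, forall A : {set 'I_n}, (A \subset Z) || (Z \subset A)} ->
  is_chain (Z |: C).
Proof.
move=> /is_chainP cC cZ; apply/is_chainP => A B.
move=> /setU1P[->|inA] /setU1P[->|inB].
- by rewrite subxx.
- by rewrite orbC cZ.
- exact: cZ.
- exact: cC.
Qed.

Lemma full_chains_level (C : {set {set 'I_n}}) (j : nat) :
  C \in full_chains -> j <= n -> #|[set A in C | #|A| == j]| = 1.
Proof.
rewrite inE => /maxsetP[cC mC] jn.
have in_C (Z : {set 'I_n}) : {in C, forall A : {set 'I_n}, (A \subset Z) || (Z \subset A)} -> Z \in C.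
  by move=> cZ; rewrite -(mC _ (is_chainU1 cC cZ) (subsetU1 _ _)) setU11.
have C0 : set0 \in C by apply: in_C => A _; rewrite sub0set orbT.
have CT : setT \in C by apply: in_C => A _; rewrite subsetT.
have /is_chainP cmp := cC.
have [X /andP[XC Xj] mX] : exists2 X : {set 'I_n}, (X \in C) && (#|X| <= j) &
    forall B, (B \in C) && (#|B| <= j) -> #|B| <= #|X|.
  have p0 : (set0 \in C) && (#|@set0 'I_n| <= j) by rewrite C0 cards0.
  by case: (@arg_maxnP _ set0
    [pred B : {set 'I_n} | (B \in C) && (#|B| <= j)] (fun B => #|B|) p0) => X; exists X.
have [Y /andP[YC jY] mY] : exists2 Y : {set 'I_n}, (Y \in C) && (j <= #|Y|) &
    forall B, (B \in C) && (j <= #|B|) -> #|Y| <= #|B|.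
  have pT : (setT \in C) && (j <= #|[set: 'I_n]|) by rewrite CT cardsT card_ord.
  by case: (@arg_minnP _ [set: 'I_n]
    [pred B : {set 'I_n} | (B \in C) && (j <= #|B|)] (fun B => #|B|) pT) => Y; exists Y.
have subC (A B : {set 'I_n}) : A \in C -> B \in C -> #|A| <= #|B| -> A \subset B.
  move=> inA inB leAB; case/orP: (cmp A B inA inB) => // BA.
  by have /eqP-> : B == A by rewrite eqEcard BA.
have sXY : X \subset Y by apply: subC => //; apply: leq_trans jY.
have [Z [XZ ZY Zj]] : exists Z : {set 'I_n},
    [/\ X \subset Z, Z \subset Y & #|Z| = j].
  have : j - #|X| <= #|Y :\: X| by rewrite cardsDS // leq_sub2r.
  case/card_geqP => s [us ss sYX].
  have cs : #|[set x in s]| = j - #|X| by rewrite cardsE (card_uniqP us).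
  exists (X :|: [set x in s]); split; first exact: subsetUl.
    rewrite subUset sXY; apply/subsetP => x; rewrite inE => /sYX.
    by rewrite inE => /andP[].
  rewrite cardsU cs (_ : _ :&: _ = set0) ?cards0 ?subn0 ?subnKC //.
  apply/setP => x; rewrite !inE; apply/negP => /andP[xX /sYX].
  by rewrite inE xX.
have ZC : Z \in C.
  apply: in_C => A inA; case: (leqP #|A| j) => [lej|/ltnW gtj].
    by rewrite (subset_trans (subC _ _ inA XC _) XZ) // mX // inA.
  by rewrite (subset_trans ZY (subC _ _ YC inA _)) ?orbT // mY // inA.
apply/eqP/cards1P; exists Z; apply/setP => A; rewrite !inE.
apply/andP/eqP => [[inA /eqP Aj]|->]; last by rewrite ZC Zj.
by apply/eqP; rewrite eqEcard (subC _ _ inA ZC) Aj Zj leqnn.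
Qed.

Lemma full_chains_gt0 : 0 < #|full_chains|.
Proof.
apply/card_gt0P.
have [] := @maxset_exists _ is_chain set0; first by apply/is_chainP => A; rewrite inE.
by move=> C mC _; exists C; rewrite inE.
Qed.

Lemma full_chains_perm (s : {perm 'I_n}) (C : {set {set 'I_n}}) :
  ([set s @: (A : {set 'I_n}) | A in C] \in full_chains) = (C \in full_chains).
Proof.
have inj (t : {perm 'I_n}) : injective (fun A : {set 'I_n} => t @: A).
  exact/imset_inj/perm_inj.
have sK (t : {perm 'I_n}) (A : {set 'I_n}) : t @: (t^-1%g @: A) = A.
  by rewrite -imset_comp -[RHS]imset_id; apply: eq_imset => x /=; rewrite permKV.
have sKC (t : {perm 'I_n}) (D : {set {set 'I_n}}) :
    [set t @: (A : {set 'I_n}) | A in [set t^-1%g @: (A : {set 'I_n}) | A in D]]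
      = D.
  by rewrite -imset_comp -[RHS]imset_id; apply: eq_imset => x /=; rewrite sK.
have chain_perm (t : {perm 'I_n}) D :
    is_chain D -> is_chain [set t @: (A : {set 'I_n}) | A in D].
  move=> /is_chainP cD; apply/is_chainP => _ _ /imsetP[A AD ->] /imsetP[B BD ->].
  by case/orP: (cD A B AD BD) => /imsetS->; rewrite ?orbT.
have imp (t : {perm 'I_n}) D : D \in full_chains ->
    [set t @: (A : {set 'I_n}) | A in D] \in full_chains.
  rewrite !inE => /maxsetP[cD mD]; apply/maxsetP; split; first exact: chain_perm.
  move=> E cE sE; rewrite -[LHS](sKC t) (mD [set t^-1%g @: (A : {set 'I_n}) | A in E]) //.
    exact: chain_perm.
  rewrite -[D](sKC t^-1%g) invgK; exact: imsetS.
apply/idP/idP => [/(imp s^-1%g)|]; last exact: imp.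
by have := sKC s^-1%g C; rewrite invgK => ->.
Qed.

Lemma perm_imset_card (A B : {set 'I_n}) :
  #|A| = #|B| -> exists s : {perm 'I_n}, s @: A = B.
Proof.
move=> AB; pose t (D : {set 'I_n}) := enum D ++ enum (~: D).
have mt D x : x \in t D by rewrite mem_cat !mem_enum inE orbN.
have ut D : uniq (t D).
  rewrite cat_uniq !enum_uniq andbT /=; apply/hasPn => x.
  by rewrite !mem_enum inE.
have st D : size (t D) = n by rewrite size_cat -!cardE cardsC card_ord.
have inj : injective (fun x => nth x (t B) (index x (t A))).
  have lt x : index x (t A) < size (t B) by rewrite (_ : size (t B) = size (t A)) ?index_mem // !st.
  move=> x y; rewrite (set_nth_default y) // => /eqP.
  by rewrite nth_uniq // => /eqP/index_inj; apply.
exists (perm inj); apply/eqP.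
rewrite eqEcard card_imset ?AB ?leqnn ?andbT; last exact: perm_inj.
apply/subsetP => _ /imsetP[x xA ->]; rewrite permE nth_cat index_cat.
have xe : x \in enum A by rewrite mem_enum.
have lt : index x (enum A) < size (enum B) by rewrite -cardE -AB cardE index_mem.
by rewrite xe lt -[_ \in B]mem_enum mem_nth.
Qed.

Lemma full_chains_through (A : {set 'I_n}) :
  #|[set C in full_chains | A \in C]| * 'C(n, #|A|) = #|full_chains|.
Proof.
have inT (B : {set 'I_n}) (C : {set {set 'I_n}}) :
    (C \in [set D in full_chains | B \in D]) = (C \in full_chains) && (B \in C).
  by rewrite in_set.
have eqc (B : {set 'I_n}) : #|B| = #|A| ->
    #|[set C in full_chains | B \in C]| = #|[set C in full_chains | A \in C]|.
  move=> BA; have [s <-] := perm_imset_card (esym BA).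
  pose g (C : {set {set 'I_n}}) := [set s @: (X : {set 'I_n}) | X in C].
  have injs : injective (fun X : {set 'I_n} => s @: X) := imset_inj (@perm_inj _ s).
  have bij : bijective g by apply/injF_bij/imset_inj.
  rewrite -(on_card_preimset (onW_bij _ bij)).
  apply: eq_card => C; rewrite inE !inT full_chains_perm; congr (_ && _).
  by rewrite mem_imset.
have lA : #|A| <= n by rewrite -[leqRHS]card_ord max_card.
have -> : 'C(n, #|A|) = #|[set B : {set 'I_n} | #|B| == #|A|]|.
  by rewrite card_draws card_ord.
rewrite mulnC -sum_nat_const.
rewrite (eq_bigr (fun B : {set 'I_n} => #|[set C in full_chains | B \in C]|));
  last by move=> B; rewrite inE => /eqP/eqc.
under eq_bigr do rewrite -sum1_card big_mkcond.
rewrite exchange_big /= -[RHS]sum1_card [RHS]big_mkcond; apply: eq_bigr => C _.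
rewrite -big_mkcondr; case: ifPn => [fC|fC].
  rewrite -[RHS](full_chains_level fC lA) -[RHS]sum1_card.
  apply: eq_bigl => B.
  by rewrite inT fC !inE andbC.
by apply: big_pred0 => B; rewrite inT (negPf fC) andbF.
Qed.

Lemma lubellE (F : {set {set 'I_n}}) :
  lubell F = (\sum_(A in F) ('C(n, #|A|)%:R)^-1)%R.
Proof.
have c0 : (#|full_chains|%:R != 0 :> rat)%R.
  by rewrite pnatr_eq0 -lt0n full_chains_gt0.
apply: (canLR (mulfK c0)); rewrite mulr_suml.
transitivity (\sum_(A in F) #|[set C in full_chains | A \in C]|%:R : rat)%R.
  rewrite -!natr_sum; congr (_%:R)%R.
  under eq_bigr do rewrite -sum1_card big_mkcond.
  under [RHS]eq_bigr do rewrite -sum1_card big_mkcond.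
  rewrite exchange_big /= [RHS]big_mkcond; apply: eq_bigr => A _.
  rewrite big_mkcond; case: ifPn => AF.
    by apply: eq_bigr => C _; rewrite in_setI AF [in RHS]in_set; case: ifP.
  by apply: big1 => C _; rewrite in_setI (negPf AF) if_same.
apply: eq_bigr => A _; rewrite -(full_chains_through A) natrM mulrC mulfK //.
rewrite pnatr_eq0 -lt0n bin_gt0.
by rewrite -[leqRHS]card_ord max_card.
Qed.

End Lubell.

(* [#|A| + m <= n] rather than [#|A| <= n - m], to avoid truncation. *)
Definition m_L_bounded (d : Order.disp_t) (P : finPOrderType d) (m : nat)
    : Prop :=
  forall (n : nat) (F : {set {set 'I_n}}),
    pfree P F -> (forall A, A \in F -> m <= #|A| /\ #|A| + m <= n) ->
    (lubell F <= (e P)%:R)%R.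

Definition L_bounded (d : Order.disp_t) (P : finPOrderType d) : Prop :=
  exists m : nat, m_L_bounded P m.

Definition has_zero (d : Order.disp_t) (P : finPOrderType d) : Prop :=
  exists x : P, forall p : P, (x <= p)%O.

Definition has_one (d : Order.disp_t) (P : finPOrderType d) : Prop :=
  exists x : P, forall p : P, (p <= x)%O.

Definition subposet (d : Order.disp_t) (P : finPOrderType d) (A : {set P})
    : Type := {x : P | x \in A}.

HB.instance Definition _ (d : Order.disp_t) (P : finPOrderType d) (A : {set P})
  := Finite.on (subposet A).
HB.instance Definition _ (d : Order.disp_t) (P : finPOrderType d) (A : {set P})
  := SubChoice.on (subposet A).
HB.instance Definition _ (d : Order.disp_t) (P : finPOrderType d) (A : {set P})
  := [SubChoice_isSubPOrder of subposet A by <: with d].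

Definition pinterval (d : Order.disp_t) (P : finPOrderType d) (a b : P)
    : {set P} := [set c | (a <= c <= b)%O].

Definition large_interval (d : Order.disp_t) (P : finPOrderType d) (a b : P)
    : Prop :=
  [/\ (a <= b)%O, e (subposet (pinterval a b)) = e P
    & forall a' b' : P, (a' <= b')%O ->
        e (subposet (pinterval a' b')) = e P ->
        pinterval a b \subset pinterval a' b' ->
        pinterval a' b' = pinterval a b].

(* A poset with the endpoints of a chosen interval; [lo <= hi] is not recorded
   here, it is part of [large_interval]. *)
Record marked_poset (d : Order.disp_t) := Marked {
  mposet :> finPOrderType d;
  lo : mposet;
  hi : mposet
}.

Section OSum.
Variables (d : Order.disp_t) (r : nat) (S : 'I_r -> marked_poset d).

Definition dsum : Type := {i : 'I_r & S i}.
HB.instance Definition _ := Finite.on dsum.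

Definition dsum_le (x y : dsum) : bool :=
  (tag x == tag y) && (tagged x <= tagged_as x y)%O.

(* [x] is the top of the interval of some [S i], and [y] is the bottom of the
   interval of [S i.+1]. *)
Definition glue (x y : dsum) : bool :=
  [&& tag y == (tag x).+1 :> nat, tagged x == hi (S (tag x))
    & tagged y == lo (S (tag y))].

Definition glue_equiv : rel dsum := connect (fun x y => glue x y || glue y x).

Definition osum : Type :=
  {X : {set dsum} | X \in equivalence_partition glue_equiv [set: dsum]}.
HB.instance Definition _ := Finite.on osum.

Definition osum_step (X Y : osum) : bool :=
  [exists x in val X, exists y in val Y, dsum_le x y].

Definition osum_le : rel osum := connect osum_step.

Lemma osum_le_refl : reflexive osum_le.
Proof. exact: connect0. Qed.

Lemma osum_le_trans : transitive osum_le.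
Proof. exact: connect_trans. Qed.

Lemma glue_equiv_refl : reflexive glue_equiv.
Proof. exact: connect0. Qed.

Lemma glue_equiv_sym : symmetric glue_equiv.
Proof. by apply: sym_connect_sym => x y; rewrite orbC. Qed.

Lemma glue_equiv_trans : transitive glue_equiv.
Proof. exact: connect_trans. Qed.

Fact osum_pi_subproof (x : dsum) :
  [set y in [set: dsum] | glue_equiv x y]
    \in equivalence_partition glue_equiv [set: dsum].
Proof. by apply/imsetP; exists x. Qed.

Definition osum_pi (x : dsum) : osum :=
  exist (fun X : {set dsum} =>
           X \in equivalence_partition glue_equiv [set: dsum])
    _ (osum_pi_subproof x).

Lemma mem_osum_pi x y : (y \in val (osum_pi x)) = glue_equiv x y.
Proof. by rewrite inE in_setT. Qed.

Lemma osum_piP x y : reflect (osum_pi x = osum_pi y) (glue_equiv x y).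
Proof.
apply: (iffP idP) => [xy|E].
  apply/val_inj/setP => z; rewrite !mem_osum_pi.
  apply/idP/idP; apply: glue_equiv_trans => //.
  by rewrite glue_equiv_sym.
by rewrite -mem_osum_pi E mem_osum_pi glue_equiv_refl.
Qed.

Lemma osum_pi_surj (X : osum) : exists x, X = osum_pi x.
Proof.
by case: X => X pX; case/imsetP: (pX) => x _ Xx; exists x; apply: val_inj.
Qed.

(* Explicit form of [osum_le] on representatives, see [osum_leP]. *)
Definition dsum_ole (x y : dsum) : bool :=
  [|| dsum_le x y,
   [&& tag x < tag y, (tagged x <= hi (S (tag x)))%O,
     (lo (S (tag y)) <= tagged y)%O &
     [forall l : 'I_r, (tag x < l < tag y) ==> (lo (S l) <= hi (S l))%O]] |
   [&& tag y < tag x, (tagged x <= lo (S (tag x)))%O,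
     (hi (S (tag y)) <= tagged y)%O &
     [forall l : 'I_r, (tag y < l < tag x) ==> (hi (S l) <= lo (S l))%O]]].

Lemma dsum_le_refl : reflexive dsum_le.
Proof. by case=> i u; rewrite /dsum_le eqxx tagged_asE lexx. Qed.

Lemma dsum_leE (i : 'I_r) (u v : S i) :
  dsum_le (Tagged S u) (Tagged S v) = (u <= v)%O.
Proof. by rewrite /dsum_le eqxx tagged_asE. Qed.

Lemma dsum_le_tag (i j : 'I_r) (u : S i) (v : S j) :
  dsum_le (Tagged S u) (Tagged S v) -> i = j.
Proof. by case/andP=> /eqP. Qed.

Lemma dsum_ole_le x y z : dsum_ole x y -> dsum_le y z -> dsum_ole x z.
Proof.
case: x y z => [i u] [j v] [l w] + jl; have E := dsum_le_tag jl.
case: l / E w jl => w; rewrite dsum_leE => vw.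
case/or3P=> [ij|/and4P[/= ij ui vj h]|/and4P[/= ij ui vj h]].
- have E := dsum_le_tag ij; case: j / E v w ij vw => v w.
  rewrite dsum_leE => uv vw.
  by apply/or3P; apply: Or31; rewrite dsum_leE (le_trans uv).
- by apply/or3P; apply: Or32; rewrite /= ij ui (le_trans vj vw).
- by apply/or3P; apply: Or33; rewrite /= ij ui (le_trans vj vw).
Qed.

Lemma dsum_ole_glue x y z : dsum_ole x y -> glue y z -> dsum_ole x z.
Proof.
case: x y z => [i u] [j v] [l w] + /and3P[/= /eqP lj /eqP vE /eqP wE].
subst v w.
case/or3P=> [ij|/and4P[/= ij ui vj /forallP h]|
             /and4P[/= ij ui vj /forallP h]].
- have E := dsum_le_tag ij; case: j / E lj ij => lj; rewrite dsum_leE => uv.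
  apply/or3P/Or32/and4P; split=> //=; first by rewrite lj.
  by apply/forallP=> q; apply/implyP; rewrite lj ltnS ltnNge andNb.
- apply/or3P/Or32/and4P; split=> //=; first by rewrite lj ltnS ltnW.
  apply/forallP=> q; apply/implyP; rewrite lj ltnS => /andP[iq].
  rewrite leq_eqVlt => /orP[/eqP/val_inj-> //|qj].
  by move/implyP: (h q); apply; rewrite iq.
- move: ij; rewrite -lj leq_eqVlt => /orP[/eqP/val_inj li|li].
    by subst l; apply/or3P/Or31; rewrite dsum_leE.
  apply/or3P/Or33/and4P; split=> //=.
    by move/implyP: (h l); apply; rewrite lj ltnSn -lj.
  apply/forallP=> q; apply/implyP => /andP[lq qi].
  by move/implyP: (h q); apply; rewrite qi andbT -lj ltnW.
Qed.

Lemma dsum_ole_eulg x y z : dsum_ole x y -> glue z y -> dsum_ole x z.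
Proof.
case: x y z => [i u] [j v] [l w] + /and3P[/= /eqP jl /eqP vE /eqP wE].
subst v w.
case/or3P=> [ij|/and4P[/= ij ui vj /forallP h]|
             /and4P[/= ij ui vj /forallP h]].
- have E := dsum_le_tag ij; case: j / E jl ij => jl; rewrite dsum_leE => uv.
  apply/or3P/Or33/and4P; split=> //=; first by rewrite jl.
  by apply/forallP=> q; apply/implyP; rewrite jl ltnS ltnNge andNb.
- move: ij; rewrite jl ltnS leq_eqVlt => /orP[/eqP/val_inj il|il].
    by subst l; apply/or3P/Or31; rewrite dsum_leE.
  apply/or3P/Or32/and4P; split=> //=.
    by move/implyP: (h l); apply; rewrite il jl /=.
  apply/forallP=> q; apply/implyP => /andP[iq ql].
  by move/implyP: (h q); apply; rewrite iq jl ltnS ltnW.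
- apply/or3P/Or33/and4P; split=> //=; first by rewrite (ltn_trans _ ij) // jl.
  apply/forallP=> q; apply/implyP=> /andP[]; rewrite -jl.
  rewrite leq_eqVlt => /orP[/eqP/val_inj<- //|jq] qi.
  by move/implyP: (h q); apply; rewrite jq.
Qed.

Lemma dsum_ole_equiv x y z : dsum_ole x y -> glue_equiv y z -> dsum_ole x z.
Proof.
move=> + /connectP[p + ->] {z}; elim: p y => //= t p IHp y xy /andP[yt].
apply: IHp; case/orP: yt; [exact: dsum_ole_glue|exact: dsum_ole_eulg].
Qed.

Lemma osum_leP x y :
  reflect (dsum_ole x y) (osum_le (osum_pi x) (osum_pi y)).
Proof.
have to_equiv a b : osum_pi a = osum_pi b -> glue_equiv a b.
  by move/osum_piP.
have step a b : dsum_le a b -> osum_le (osum_pi a) (osum_pi b).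
  move=> ab; apply: connect1; apply/exists_inP; exists a.
    by rewrite mem_osum_pi glue_equiv_refl.
  by apply/exists_inP; exists b; rewrite ?mem_osum_pi ?glue_equiv_refl.
have piE a b : glue a b -> osum_pi a = osum_pi b.
  by move=> ab; apply/osum_piP/connect1; rewrite ab.
apply: (iffP connectP) => [[p]|].
  elim/last_ind: p y => [|p Z IHp] y /=.
    move=> _ /to_equiv; rewrite glue_equiv_sym; apply: dsum_ole_equiv.
    by rewrite /dsum_ole dsum_le_refl.
  rewrite rcons_path last_rcons => /andP[pp sZ] yZ.
  case/exists_inP: sZ => a aL /exists_inP[b bZ ab].
  have La : last (osum_pi x) p = osum_pi a.
    case: (osum_pi_surj (last (osum_pi x) p)) aL => q ->.
    by rewrite mem_osum_pi => /osum_piP.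
  have /dsum_ole_le/(_ ab)/dsum_ole_equiv : dsum_ole x a by apply: IHp.
  by apply; rewrite glue_equiv_sym -mem_osum_pi yZ.
move=> xy; apply/connectP; rewrite -/(osum_le _ _).
have chain (m : nat) (i j : 'I_r) : j = (i + m).+1 :> nat ->
    [forall l : 'I_r, (i < l < j) ==> (lo (S l) <= hi (S l))%O] ->
    osum_le (osum_pi (Tagged S (hi (S i)))) (osum_pi (Tagged S (lo (S j)))).
  elim: m j => [|m IHm] j ji /forallP h.
    rewrite (@piE (Tagged S (hi (S i))) (Tagged S (lo (S j)))) ?osum_le_refl //.
    by rewrite /glue /= !eqxx ji addn0 eqxx.
  have lt : (i + m).+1 < r by rewrite (leq_trans _ (ltn_ord j)) // ji addnS.
  pose l := Ordinal lt.
  rewrite -(@piE (Tagged S (hi (S l))) (Tagged S (lo (S j)))); last first.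
    by rewrite /glue /= !eqxx ji addnS eqxx.
  apply: osum_le_trans (IHm l _ _) _ => //; last first.
    apply: step; rewrite dsum_leE.
    by move/implyP: (h l); apply; rewrite /= ltnS leq_addr ji addnS /=.
  apply/forallP=> q; apply/implyP=> /andP[iq ql].
  by move/implyP: (h q); apply; rewrite iq (ltn_trans ql) //= ji addnS.
have chainV (m : nat) (i j : 'I_r) : i = (j + m).+1 :> nat ->
    [forall l : 'I_r, (j < l < i) ==> (hi (S l) <= lo (S l))%O] ->
    osum_le (osum_pi (Tagged S (lo (S i)))) (osum_pi (Tagged S (hi (S j)))).
  elim: m i => [|m IHm] i ij /forallP h.
    rewrite -(@piE (Tagged S (hi (S j))) (Tagged S (lo (S i)))) ?osum_le_refl //.
    by rewrite /glue /= !eqxx ij addn0 eqxx.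
  have lt : (j + m).+1 < r by rewrite (leq_trans _ (ltn_ord i)) // ij addnS.
  pose l := Ordinal lt.
  rewrite -(@piE (Tagged S (hi (S l))) (Tagged S (lo (S i)))); last first.
    by rewrite /glue /= !eqxx ij addnS eqxx.
  apply: osum_le_trans _ (IHm l _ _) => //.
    apply: step; rewrite dsum_leE.
    by move/implyP: (h l); apply; rewrite /= ltnS leq_addr ij addnS /=.
  apply/forallP=> q; apply/implyP=> /andP[jq ql].
  by move/implyP: (h q); apply; rewrite jq (ltn_trans ql) //= ij addnS.
case: x y xy => [i u] [j v] /or3P[/step //|/and4P[/= ij ui vj h]|
  /and4P[/= ij ui vj h]].
- apply: osum_le_trans (step (Tagged S u) (Tagged S (hi (S i))) _) _.
    by rewrite dsum_leE.
  apply: osum_le_trans (chain (j - i.+1) i j _ h) (step _ (Tagged S v) _).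
    by rewrite -addSn subnKC.
  by rewrite dsum_leE.
- apply: osum_le_trans (step (Tagged S u) (Tagged S (lo (S i))) _) _.
    by rewrite dsum_leE.
  apply: osum_le_trans (chainV (i - j.+1) i j _ h) (step _ (Tagged S v) _).
    by rewrite -addSn subnKC.
  by rewrite dsum_leE.
Qed.

Lemma glue_equiv_chain (m : nat) (i j : 'I_r) : j = (i + m).+1 :> nat ->
  (forall l : 'I_r, i < l < j -> lo (S l) = hi (S l)) ->
  glue_equiv (Tagged S (hi (S i))) (Tagged S (lo (S j))).
Proof.
have piE a b : glue a b -> glue_equiv a b by move=> ab; apply: connect1; rewrite ab.
elim: m j => [|m IHm] j ji h.
  by apply: piE; rewrite /glue /= !eqxx ji addn0 eqxx.
have lt : (i + m).+1 < r by rewrite (leq_trans _ (ltn_ord j)) // ji addnS.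
pose l := Ordinal lt.
have il : i < l < j by rewrite /= ltnS leq_addr ji addnS /=.
apply: glue_equiv_trans (IHm l _ _) _ => //.
  move=> q /andP[iq ql]; apply: h.
  by rewrite iq (ltn_trans ql) //= ji addnS.
by rewrite h //; apply: piE; rewrite /glue /= !eqxx ji addnS eqxx.
Qed.

Lemma dsum_ole_anti x y : dsum_ole x y -> dsum_ole y x -> glue_equiv x y.
Proof.
wlog : x y / tag x <= tag y.
  move=> W xy yx; case/orP: (leq_total (tag x) (tag y)) => ?; first exact: W.
  by rewrite glue_equiv_sym; apply: W.
case: x y => [i u] [j v] /=; rewrite leq_eqVlt => /orP[/eqP/val_inj ij|ij].
  case: j / ij v => v; rewrite /dsum_ole /= ltnn !orbF !dsum_leE => uv vu.
  by rewrite (@le_anti _ _ u v) ?uv // glue_equiv_refl.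
have ji : j < i = false by rewrite ltnNge ltnW.
have nij : (i == j) = false by apply/negP => /eqP E; rewrite E ltnn in ij.
rewrite /dsum_ole /dsum_le /= ij ji nij eq_sym nij /= orbF.
move=> /and3P[ui vj /forallP h] /and3P[vj' ui' /forallP h'].
rewrite (@le_anti _ _ u (hi (S i))) ?ui // (@le_anti _ _ v (lo (S j))) ?vj ?vj' //.
apply: (@glue_equiv_chain (j - i.+1)); first by rewrite -addSn subnKC.
move=> l il; apply: le_anti.
by rewrite (implyP (h l) il) (implyP (h' l) il).
Qed.

Lemma osum_le_anti : antisymmetric osum_le.
Proof.
move=> X Y; have [x ->] := osum_pi_surj X; have [y ->] := osum_pi_surj Y.
by case/andP=> /osum_leP xy /osum_leP yx; apply/osum_piP/dsum_ole_anti.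
Qed.

HB.instance Definition _ :=
  Order.Le_isPOrder.Build d osum osum_le_refl osum_le_anti osum_le_trans.

End OSum.

(* The summands are listed as [Q 0, ..., Q (l - 1), P 0, ..., P (k - 1)]. *)
Definition ffcat (T : Type) (l k : nat) (Q : 'I_l -> T) (P : 'I_k -> T)
    (i : 'I_(l + k)) : T :=
  match split i with inl j => Q j | inr j => P j end.

(* Main.v *)
(* Peeling.  If S has a least element z, split a family G into
   G' = {A in G : some copy of S in G sends z to A} and G \ G'.  The latter is
   S-free.  If A is in G' and A' is maximal among the members of G' containing
   A, then a copy of S over A' has only its bottom in G', and that bottom can be
   moved down to A: so S embeds over A with every other element in G \ G'.
   Peeling P_k, ..., P_2 or P_1 from above, and dually Q_1, ..., Q_(l-1) from
   below, cuts an R-free family into one layer per summand, each free of its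
   summand: copies of the summands in the layers could be glued one after the
   other, disjointness being automatic.  Hence the Lubell function is at most
   the sum of the e(P_i) and e(Q_j).  This sum is at most e(R), because a copy of
   R contains the large intervals stacked on each other, and a copy of the
   large interval of S spans more than e(S) levels. *)

Require Import Defs.
From HB Require Import structures.
From mathcomp Require Import all_boot all_order all_algebra.
From mathcomp Require Import boolp zify.

Set Implicit Arguments.
Unset Strict Implicit.
Unset Printing Implicit Defensive.

Import Order.TTheory GRing.Theory Num.Theory.

(** * Roots of copies and how to move them *)

(* [rs] and [rt] are the orders for peeling from above, and their converses for
   peeling from below. *)
Section Peel.
Variables (S T : finType) (rs : rel S) (rt : rel T) (z : S).

Definition embeds (G : {set T}) (f : S -> T) : Prop :=
  [/\ injective f, forall x, f x \in G & forall x y, rs x y -> rt (f x) (f y)].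

Definition roots (G : {set T}) : {set T} :=
  [set A | `[< exists2 f, embeds G f & f z = A >]].

Lemma rootsP (G : {set T}) A :
  reflect (exists2 f, embeds G f & f z = A) (A \in roots G).
Proof. by rewrite inE; apply: asboolP. Qed.

Lemma roots_sub (G : {set T}) : roots G \subset G.
Proof. by apply/subsetP=> A /rootsP[f [_ fG _] <-]. Qed.

Lemma not_embeds_nonroots (G : {set T}) f : ~ embeds (G :\: roots G) f.
Proof.
case=> fI fG fM; have /setDP[_ /rootsP[]] := fG z.
by exists f => //; split=> // x; have /setDP[] := fG x.
Qed.

Hypotheses (rt_refl : reflexive rt) (rt_anti : antisymmetric rt).
Hypotheses (rt_trans : transitive rt) (z_min : forall x, rs z x).
Hypothesis rs_z : forall x, rs x z -> x = z.

(** Among the members of [G] above [A], one with the largest [rt]-down-set is maximal: anything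
    above it in [G] has a down-set containing, hence equal to, its own. This measure fits both
    inclusion and its converse. *)
Lemma maximal_above (G : {set T}) A : A \in G ->
  exists2 B, B \in G /\ rt A B & forall C, C \in G -> rt B C -> C = B.
Proof.
move=> AG; pose low X := [set Y | rt Y X].
have pA : (A \in G) && rt A A by rewrite AG rt_refl.
case: (@arg_maxnP _ A [pred X | (X \in G) && rt A X] (fun X => #|low X|) pA).
move=> B /andP[BG AB] maxB; exists B => // C CG BC; apply: rt_anti.
have sBC : low B \subset low C.
  by apply/subsetP=> Y; rewrite !inE => YB; apply: rt_trans BC.
rewrite BC andbT; have: C \in low C by rewrite inE.
suff /eqP<- : low B == low C by rewrite inE.
by rewrite eqEcard sBC; apply: maxB; rewrite inE CG (rt_trans AB).
Qed.

Lemma rootsE (G : {set T}) A : A \in roots G ->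
  exists f, [/\ embeds G f, f z = A
    & forall x, x != z -> f x \notin roots G].
Proof.
move=> AR; have AG := subsetP (roots_sub G) _ AR.
case/maximal_above: AR => B [/rootsP[f [fI fG fM] fz] AB] maxB.
have Bf x : rt B (f x) by rewrite -fz fM.
(* An image equal to [A] lies above [B], and [A] lies below [B], so both equal [f z]. Hence
   redirecting [z] to [A] keeps the map injective. *)
have fA x : f x = A -> x = z.
  by move=> fx; apply: fI; rewrite fz; apply: rt_anti; rewrite Bf fx AB.
exists (fun x => if x == z then A else f x); rewrite eqxx.
split=> // [|x /negPf xz]; last first.
  by rewrite xz; apply/negP=> /maxB/(_ (Bf x)); rewrite -fz => /fI/eqP; rewrite xz.
split=> [x y|x|x y xy].
- case: eqP => [->|xz]; case: eqP => [->|yz] //; first by move/esym/fA.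
    by move/fA.
  exact: fI.
- by case: ifP.
- case: (x =P z) xy => [_ _|xz xy]; case: eqP => [yz|_] //.
  + exact: rt_trans (Bf y).
  + by case: xz; apply: rs_z; rewrite -yz.
  + exact: fM.
Qed.
End Peel.

(** * Layers and glued copies, one summand at a time *)

Section Layers.
Variables (d : Order.disp_t) (r n : nat) (S : 'I_r -> marked_poset d).
Local Notation T := {set 'I_n}.
Local Notation update g f := (@dfwith _ (fun i => S i -> T) g _ f).
Implicit Types (D : pred 'I_r) (G : {set T}) (g : forall i, S i -> T).

Definition gval g (x : dsum S) : T := g (tag x) (tagged x).

(* A copy in [G] of the part of [osum S] made of the summands indexed by [D]. *)
Definition glued D G g : Prop :=
  [/\ forall i x, D i -> g i x \in G,
      forall i (x y : S i), D i -> (x <= y)%O -> g i x \subset g i y,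
      forall x y, D (tag x) -> D (tag y) -> glue x y -> gval g x = gval g y
    & forall x y, D (tag x) -> D (tag y) -> gval g x = gval g y ->
        glue_equiv x y].

Definition layered D G : Prop :=
  exists c : T -> 'I_r, (forall A, A \in G -> D (c A)) /\
    forall i, D i -> pfree (S i) [set A in G | c A == i].

(** Quantified over all [G], because the induction applies it to the roots in [G] and not to [G]
    itself. *)
Definition splittable D : Prop :=
  forall G, layered D G \/ exists g, glued D G g.

Lemma pfree_sub (e' : Order.disp_t) (P : finPOrderType e') m
    (F F' : {set {set 'I_m}}) : F \subset F' -> pfree P F' -> pfree P F.
Proof.
move=> /subsetP sF fF [f [fI fF1 fM]]; apply: fF.
by exists f; split=> // u; apply: sF.
Qed.

Lemma glue_tag_neq (x y : dsum S) : glue x y -> tag x != tag y.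
Proof.
by case/and3P=> /eqP xy _ _; apply: contra_eq_neq xy => ->; rewrite neq_ltn ltnSn.
Qed.

Lemma splittable1 i : splittable (pred1 i).
Proof.
move=> G; have [[f [fI fG fM]]|nf] := pselect (contains (S i) G); last first.
  left; exists (fun=> i); split=> [A _|j /eqP ->]; first by rewrite /= eqxx.
  by apply: pfree_sub nf; apply/subsetP=> A; rewrite inE => /andP[].
(* [set0] is a placeholder: [glued] constrains only the summands indexed by [D]. *)
right; exists (update (fun j => fun=> set0) f).
split=> [j x /eqP ij|j x y /eqP ij|x y /eqP xi /eqP yi|].
- by case: _ / (esym ij) x => x; rewrite dfwith_in.
- by case: _ / (esym ij) x y => x y; rewrite dfwith_in; apply: fM.
- by move/glue_tag_neq; rewrite xi yi eqxx.
- case=> [j x] [k y] /= /eqP ij /eqP ik; rewrite /gval /=.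
  case: _ / (esym ij) x => x; case: _ / (esym ik) y => y.
  by rewrite dfwith_in => /fI->; apply: glue_equiv_refl.
Qed.

Section Step.
Variables (D : pred 'I_r) (p j : 'I_r) (vp : S p) (z : S j).
Variables (rs : rel (S j)) (rt : rel T).
Hypotheses (rt_refl : reflexive rt) (rt_anti : antisymmetric rt).
Hypotheses (rt_trans : transitive rt) (z_min : forall x, rs z x).
Hypothesis rs_z : forall x, rs x z -> x = z.
Hypothesis rsE : forall f : S j -> T,
  (forall x y, rs x y -> rt (f x) (f y)) <->
  (forall x y, (x <= y)%O -> f x \subset f y).
Hypotheses (Dj : ~~ D j) (Dp : D p).
Hypothesis glue_pj : glue_equiv (Tagged S vp) (Tagged S z).
Hypothesis glue_only : forall x y, D (tag x) -> tag y = j ->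
  glue x y || glue y x -> x = Tagged S vp /\ y = Tagged S z.

(** [S j] is peeled first, and the dichotomy for [D] is applied to the roots. If these are layered,
    the non-roots become the layer of [j]. Otherwise the copy [g] in the roots is extended by a copy
    of [S j] rooted at [g p vp]. By [rsE] the pair of orders may be the given one or its
    converse. *)
Lemma splittable_step : splittable D -> splittable (predU1 j D).
Proof.
move=> splD G; have DE i : D i -> i != j by apply: contraTneq => ->.
case: (splD (roots rs rt z G)) => [[c [cD cF]]|[g [gG gM gglue gI]]].
  left; exists (fun A => if A \in roots rs rt z G then c A else j).
  split=> [A AG|i].
    by case: ifP => [/cD /= ->|_]; rewrite /= ?eqxx ?orbT.
  case/predU1P => [->|Di].
    case=> f [fI fG fM]; apply: (@not_embeds_nonroots _ _ rs rt z G f).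
    split=> // [x|]; last exact/rsE.
    have /setIdP[xG] := fG x; rewrite in_setD xG andbT.
    by case: ifP => // /cD + /eqP E; rewrite E (negPf Dj).
  apply: pfree_sub (cF i Di); apply/subsetP=> A /setIdP[_].
  case: ifP => [AR /eqP E|_ /eqP E]; first by rewrite in_set AR E eqxx.
  by have := DE i Di; rewrite -E eqxx.
have AR : g p vp \in roots rs rt z G by apply: gG.
have [f [[fI fG fM] fz fN]] := rootsE rt_refl rt_anti rt_trans z_min rs_z AR.
move/rsE: fM => fM.
right; exists (update g f).
have hj x : (update g f) j x = f x by rewrite dfwith_in.
have hD i (x : S i) : D i -> (update g f) i x = g i x.
  by move=> /DE ij; rewrite dfwith_out // eq_sym.
have vj (y : S j) : gval (update g f) (Tagged S y) = f y by rewrite /gval hj.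
have vD x : D (tag x) -> gval (update g f) x = gval g x by move=> Dx; apply: hD.
(* Off [z] the new copy consists of non-roots while [g] takes roots as values, so the two can meet
   only at [z]. There the injectivity of [g] modulo gluing leads back to [vp]. *)
have cross x (y : S j) : D (tag x) ->
    gval (update g f) x = gval (update g f) (Tagged S y) ->
    glue_equiv x (Tagged S y).
  move=> Dx; rewrite vD // vj; have [->|yz] := eqVneq y z.
    by rewrite fz => xp; apply: glue_equiv_trans (gI x (Tagged S vp) Dx Dp xp) _.
  by move=> xy; have := fN y yz; rewrite -xy gG.
split=> [i x|i x y|x y|].
- case/predU1P=> [ij|Di]; last first.
    by rewrite hD // (subsetP (roots_sub rs rt z G)) ?gG.
  by case: _ / (esym ij) x => x; rewrite hj; apply: fG.
- case/predU1P=> [ij|Di]; last by rewrite !hD //; apply: gM.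
  by case: _ / (esym ij) x y => x y; rewrite !hj; apply: fM.
- move=> /predU1P[xj|Dx] /predU1P[yj|Dy] xy.
  + by have := glue_tag_neq xy; rewrite xj yj eqxx.
  + have [|-> ->] := glue_only Dy xj; first by rewrite xy orbT.
    by rewrite vj vD.
  + have [|-> ->] := glue_only Dx yj; first by rewrite xy.
    by rewrite vj vD.
  + by rewrite !vD //; apply: gglue.
case=> [i x] [k y] /= /predU1P[ij|Di] /predU1P[kj|Dk].
- case: _ / (esym ij) x => x; case: _ / (esym kj) y => y.
  by rewrite !vj => /fI->; apply: glue_equiv_refl.
- case: _ / (esym ij) x => x /esym xy; rewrite glue_equiv_sym.
  exact: cross xy.
- case: _ / (esym kj) y => y; exact: cross.
- by rewrite !vD //; apply: gI.
Qed.
End Step.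

Lemma splittable_eq D D' : D =1 D' -> splittable D -> splittable D'.
Proof. by move=> /funext ->. Qed.

Variable i0 : 'I_r.
Hypothesis lo_min : forall i : 'I_r, i0 < i -> forall x, (lo (S i) <= x)%O.
Hypothesis hi_max : forall i : 'I_r, i < i0 -> forall x, (x <= hi (S i))%O.

Lemma glue_glue_equiv (x y : dsum S) : glue x y -> glue_equiv x y.
Proof. by move=> xy; apply: connect1; rewrite xy. Qed.

Lemma glueE (x y : dsum S) : glue x y ->
  [/\ tag y = (tag x).+1 :> nat, x = Tagged S (hi (S (tag x)))
    & y = Tagged S (lo (S (tag y)))].
Proof.
by case: x y => [i x] [j y] /and3P[/eqP/= ij /eqP/= <- /eqP/= <-].
Qed.

(** Induction from the pivot [i0]: each new summand hangs by its least element [lo] on the top [hi]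
    of the previous one. *)
Lemma splittable_up m : i0 + m < r ->
  splittable [pred i : 'I_r | i0 <= i <= i0 + m].
Proof.
elim: m => [|m IHm] lt_m.
  apply: splittable_eq (@splittable1 i0) => i /=.
  by rewrite addn0 -eqn_leq eq_sym.
have lt_m' : i0 + m < r by rewrite addnS in lt_m; apply: ltnW.
pose j := Ordinal lt_m; pose p := Ordinal lt_m'.
have i0j : i0 < j by rewrite /= addnS ltnS leq_addr.
have pj : glue (Tagged S (hi (S p))) (Tagged S (lo (S j))).
  by rewrite /glue /= addnS !eqxx.
apply: (@splittable_eq (predU1 j [pred i : 'I_r | i0 <= i <= i0 + m])).
  move=> i; rewrite /= -val_eqE /= addnS; lia.
apply: (@splittable_step _ p j (hi (S p)) (lo (S j)) (fun x y => (x <= y)%O)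
  (fun A B : T => A \subset B)) (IHm lt_m').
- exact: subxx.
- by move=> A B; rewrite -eqEsubset => /eqP.
- by move=> A B C; apply: subset_trans.
- exact: lo_min.
- by move=> x xz; apply: le_anti; rewrite xz lo_min.
- by [].
- by rewrite /= addnS ltnn andbF.
- by rewrite /= leq_addr leqnn.
- exact: glue_glue_equiv.
(* A gluing of [y] below [x] would give [x] the index [j + 1], beyond the range already treated. *)
- move=> x y /= /andP[_ lex] yj /orP[/glueE[xy -> ->]|/glueE[xy _ _]].
    have xp : tag x = p by apply: val_inj; move: xy; rewrite yj /= addnS => -[].
    by rewrite yj xp.
  by move: lex; rewrite xy yj /=; lia.
Qed.

(** The base case is the whole upper part, from [i0] to the last index [r.-1]. Each further summand
    is added below with both orders reversed, so that its greatest element [hi] plays the root. *)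
Lemma splittable_down m : m <= i0 ->
  splittable [pred i : 'I_r | i0 - m <= i].
Proof.
elim: m => [|m IHm] le_m.
  have E : i0 + (r.-1 - i0) = r.-1 by have := ltn_ord i0; lia.
  apply: splittable_eq (@splittable_up (r.-1 - i0) _); last first.
    by rewrite E; have := ltn_ord i0; lia.
  by move=> i /=; rewrite E; have := ltn_ord i; lia.
have lt_j : i0 - m.+1 < r by have := ltn_ord i0; lia.
have lt_p : i0 - m < r by have := ltn_ord i0; lia.
pose j := Ordinal lt_j; pose p := Ordinal lt_p.
have ji0 : j < i0 by rewrite /=; lia.
have jp : p = j.+1 :> nat by rewrite /=; lia.
have glue_jp : glue (Tagged S (hi (S j))) (Tagged S (lo (S p))).
  by rewrite /glue jp !eqxx.
apply: (@splittable_eq (predU1 j [pred i : 'I_r | i0 - m <= i])).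
  move=> i; rewrite /= -val_eqE /=; lia.
apply: (@splittable_step _ p j (lo (S p)) (hi (S j)) (fun x y => (y <= x)%O)
  (fun A B : T => B \subset A)) (IHm (ltnW le_m)).
- exact: subxx.
- by move=> A B; rewrite andbC -eqEsubset => /eqP.
- by move=> A B C BA CA; apply: subset_trans BA.
- exact: hi_max.
- by move=> x xz; apply: le_anti; rewrite xz hi_max.
- by move=> f; split=> fM x y; apply: fM.
- by rewrite /=; lia.
- by rewrite /=.
- by rewrite glue_equiv_sym; apply: glue_glue_equiv.
- move=> x y /= lex yj /orP[/glueE[xy _ _]|/glueE[xy -> ->]].
    by move: lex; have := congr1 val yj; rewrite /= xy; lia.
  have xp : tag x = p by apply: val_inj; rewrite /= xy yj -jp.
  by rewrite yj xp.
Qed.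

(** [gval g] is constant on gluing classes and separates them, so it descends to the quotient
    through the representatives [rep]. Monotonicity is checked along a path of steps, each inside
    one summand. *)
Lemma contains_osum G g : glued predT G g -> contains (osum S) G.
Proof.
case=> gG gM gglue gI; have [rep repE] := choice (@osum_pi_surj _ _ S).
have gE x y : glue_equiv x y -> gval g x = gval g y.
  case/connectP=> s + ->; elim: s x => //= t s IHs x /andP[xt /IHs <-].
  by case/orP: xt => /gglue ->.
have grep (X : osum S) x : x \in val X -> gval g (rep X) = gval g x.
  by rewrite {1}(repE X) mem_osum_pi; apply: gE.
exists (fun X => gval g (rep X)); split=> [X Y XY|X|X Y].
- by rewrite (repE X) (repE Y); apply/osum_piP/gI.
- exact: gG.
case/connectP=> s + ->; elim: s X => //= Z s IHs X /andP[XZ /IHs].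
apply: subset_trans; case/exists_inP: XZ => -[i x] xX /exists_inP[[k y] yZ].
case/andP=> /= /eqP ik; case: _ / ik y yZ => y yZ; rewrite tagged_asE.
by rewrite (grep _ _ xX) (grep _ _ yZ); apply: gM.
Qed.

Lemma layered_osum G : pfree (osum S) G -> layered predT G.
Proof.
move=> fG; have spl : splittable predT.
  apply: splittable_eq (@splittable_down i0 _) => // i.
  by rewrite /= subnn.
by case: (spl G) => // -[g /contains_osum].
Qed.

End Layers.

(** * Monotonicity of [e] and endpoints of large intervals *)

Lemma leq_e (d d' : Order.disp_t) (P : finPOrderType d) (P' : finPOrderType d')
    (h : P -> P') :
  0 < #|P| -> injective h -> (forall x y, (x <= y)%O -> (h x <= h y)%O) ->
  e P <= e P'.
Proof.
move=> P0 hI hM; have [freeP _] := e_max P0.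
have P'0 : 0 < #|P'|.
  by have /card_gt0P[x _] := P0; apply/card_gt0P; exists (h x).
have [_ maxP'] := e_max P'0; apply: maxP' => n s [f [fI fL fM]].
apply: (freeP n s); exists (f \o h); split=> [|u|u v uv] /=.
- exact: inj_comp.
- exact: fL.
- exact/fM/hM.
Qed.

Lemma card_subposet_gt0 (d : Order.disp_t) (P : finPOrderType d) (A : {set P}) :
  A != set0 -> 0 < #|{: subposet A}|.
Proof. by case/set0Pn=> x xA; apply/card_gt0P; exists (Sub x xA). Qed.

Lemma e_subposet (d : Order.disp_t) (P : finPOrderType d) (A B : {set P}) :
  A != set0 -> A \subset B -> e (subposet A) <= e (subposet B).
Proof.
move=> /card_subposet_gt0 A0 AB.
pose h (u : subposet A) : subposet B := Sub (val u) (subsetP AB _ (valP u)).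
by apply: (leq_e (h := h) A0) => // u v /(congr1 val) uv; apply: val_inj.
Qed.

Lemma e_subposet_le (d : Order.disp_t) (P : finPOrderType d) (A : {set P}) :
  A != set0 -> e (subposet A) <= e P.
Proof.
move=> /card_subposet_gt0 A0.
pose h (u : subposet A) := val u.
by apply: (leq_e (h := h) A0) => //; apply: val_inj.
Qed.

(** Extending the interval down to the least element [z] keeps its [e] squeezed between that of the
    large interval and [e P]. Maximality then puts [z] into the large interval. *)
Lemma large_interval_lo (d : Order.disp_t) (P : finPOrderType d) (a b : P) :
  large_interval a b -> has_zero P -> forall x, (a <= x)%O.
Proof.
case=> ab eab maxab [z zmin] x; have zb := zmin b.
have sub : pinterval a b \subset pinterval z b.
  by apply/subsetP=> c; rewrite !inE zmin => /andP[].
have a0 : pinterval a b != set0 by apply/set0Pn; exists a; rewrite inE lexx.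
have z0 : pinterval z b != set0 by apply/set0Pn; exists z; rewrite inE lexx.
have ezb : e (subposet (pinterval z b)) = e P.
  by apply/eqP; rewrite eqn_leq e_subposet_le // -eab e_subposet.
have : z \in pinterval z b by rewrite inE lexx.
by rewrite (maxab z b) // inE => /andP[az _]; apply: le_trans (zmin x).
Qed.

Lemma large_interval_hi (d : Order.disp_t) (P : finPOrderType d) (a b : P) :
  large_interval a b -> has_one P -> forall x, (x <= b)%O.
Proof.
case=> ab eab maxab [z zmax] x; have az := zmax a.
have sub : pinterval a b \subset pinterval a z.
  by apply/subsetP=> c; rewrite !inE zmax => /andP[->].
have b0 : pinterval a b != set0 by apply/set0Pn; exists a; rewrite inE lexx.
have z0 : pinterval a z != set0 by apply/set0Pn; exists a; rewrite inE lexx.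
have eaz : e (subposet (pinterval a z)) = e P.
  by apply/eqP; rewrite eqn_leq e_subposet_le // -eab e_subposet.
have : z \in pinterval a z by rewrite inE lexx andbT.
by rewrite (maxab a z) // inE => /andP[_ zb]; apply: le_trans zb.
Qed.

(* A copy of [a, b] within fewer levels would lie in [e] consecutive ones. *)
Lemma interval_span (d : Order.disp_t) (P : finPOrderType d) (a b : P) n
    (f : P -> {set 'I_n}) :
  (a <= b)%O -> injective f ->
  (forall x y, (x <= y)%O -> f x \subset f y) ->
  #|f a| + e (subposet (pinterval a b)) <= #|f b|.
Proof.
move=> ab fI fM; rewrite leqNgt; apply/negP=> lt_b.
have ain : a \in pinterval a b by rewrite inE lexx.
have I0 : 0 < #|{: subposet (pinterval a b)}|.
  by apply: card_subposet_gt0; apply/set0Pn; exists a.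
have [free_e _] := e_max I0; apply: (free_e n #|f a|).
exists (fun u => f (val u)); split=> [u v /fI/val_inj //|u|u v]; last exact: fM.
have := valP u; rewrite !inE => /andP[/fM/subset_leq_card le_a].
move=> /fM/subset_leq_card le_b.
by rewrite -PoszD lez_nat ltz_nat le_a (leq_ltn_trans le_b).
Qed.

(** * Stacking the large intervals *)

Section OsumE.
Variables (d : Order.disp_t) (r : nat) (S : 'I_r -> marked_poset d).
Hypothesis large_S : forall i, large_interval (lo (S i)) (hi (S i)).

(** On equal tags the explicit order [dsum_ole] reduces to the order of the summand, so antisymmetry
    applies. *)
Lemma osum_pi_inj i : injective (fun x : S i => osum_pi (Tagged S x)).
Proof.
have le_of_pi (x y : S i) :
    osum_pi (Tagged S x) = osum_pi (Tagged S y) -> (x <= y)%O.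
  move=> xy; have /osum_leP : osum_le (osum_pi (Tagged S x)) (osum_pi (Tagged S y)).
    by rewrite xy osum_le_refl.
  by rewrite /dsum_ole /= ltnn /= orbF dsum_leE.
by move=> x y xy; apply: le_anti; rewrite !le_of_pi.
Qed.

Lemma osum_pi_mono i (x y : S i) :
  (x <= y)%O -> (osum_pi (Tagged S x) <= osum_pi (Tagged S y))%O.
Proof. by move=> xy; apply/osum_leP; rewrite /dsum_ole dsum_leE xy. Qed.

Lemma sum_e_le_osum : 0 < r -> \sum_(i < r) e (S i) <= e (osum S).
Proof.
move=> r0; pose i1 := Ordinal r0; have R0 : 0 < #|{: osum S}|.
  by apply/card_gt0P; exists (osum_pi (Tagged S (lo (S i1)))).
have [_ maxR] := e_max R0; apply: maxR => n s [f [fI fL fM]].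
pose A i := #|f (osum_pi (Tagged S (lo (S i))))|.
pose B i := #|f (osum_pi (Tagged S (hi (S i))))|.
have span i : A i + e (S i) <= B i.
  have [lohi <- _] := large_S i.
  apply: (@interval_span _ _ _ _ _ (fun x => f (osum_pi (Tagged S x)))) => //.
    by move=> x y /fI/osum_pi_inj.
  by move=> x y /osum_pi_mono/fM.
have stack m (lt_m : m < r) :
    A i1 + \sum_(i < r | i <= m) e (S i) <= B (Ordinal lt_m).
  elim: m lt_m => [|m IHm] lt_m.
    rewrite (big_pred1 i1) => [|i]; last by rewrite /= -val_eqE leqn0.
    by rewrite (_ : Ordinal lt_m = i1) //; apply: val_inj.
  have lt_m' := ltnW lt_m.
  rewrite (bigD1 (Ordinal lt_m)) //= addnCA addnC.
  apply: leq_trans (span _); rewrite leq_add2r.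
  (* The bottom of this interval is glued to the top of the previous one, so the spans add up
     exactly. *)
  rewrite (_ : A (Ordinal lt_m) = B (Ordinal lt_m')); last first.
    rewrite /A /B; congr #|f _|; apply/esym/osum_piP/connect1.
    by rewrite /glue /= !eqxx.
  rewrite (eq_bigl (fun i : 'I_r => i <= m)) => [|i]; first exact: IHm.
  by rewrite -val_eqE /=; lia.
have lt_r : r.-1 < r by rewrite prednK.
have := stack _ lt_r.
rewrite (eq_bigl xpredT) => [le_B|i]; last by rewrite /= -ltnS prednK // ltn_ord.
(* The lowest bottom has size at least [s] and the highest top has size less than [s] plus the sum,
   which contradicts [stack]. *)
have := fL (osum_pi (Tagged S (lo (S i1)))).
have := fL (osum_pi (Tagged S (hi (S (Ordinal lt_r))))).
rewrite !inE -/(A _) -/(B _); move: le_B.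
by move: (A _) (B _) (\sum_i e _) => a b K; lia.
Qed.

End OsumE.

(** * Summing the Lubell bounds over the layers *)

Lemma m_L_bounded_leq (d : Order.disp_t) (P : finPOrderType d) m m' :
  m <= m' -> m_L_bounded P m -> m_L_bounded P m'.
Proof.
move=> mm' bP n F fF sF; apply: bP fF _ => A /sF[mA mA'].
by split; [apply: leq_trans mA | apply: leq_trans mA'; rewrite leq_add2l].
Qed.

Lemma lubell_partition n (I : finType) (c : {set 'I_n} -> I) F :
  lubell F = (\sum_i lubell [set A in F | c A == i])%R.
Proof.
rewrite lubellE (partition_big c predT) //=; apply: eq_bigr => i _.
by rewrite lubellE; apply: eq_bigl => A; rewrite inE.
Qed.

Lemma osum_L_bounded (d : Order.disp_t) (r : nat) (S : 'I_r -> marked_poset d)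
    (i0 : 'I_r) :
  (forall i, L_bounded (S i)) ->
  (forall i, large_interval (lo (S i)) (hi (S i))) ->
  (forall i : 'I_r, i0 < i -> has_zero (S i)) ->
  (forall i : 'I_r, i < i0 -> has_one (S i)) ->
  L_bounded (osum S).
Proof.
move=> /choice[m mP] large_S zero_S one_S.
(* The maximum serves every layer at once, since the size restriction passes to subfamilies. *)
exists (\max_i m i) => n F fF sF.
have [] := @layered_osum d r n S i0 _ _ F fF.
- by move=> i /zero_S; apply: large_interval_lo.
- by move=> i /one_S; apply: large_interval_hi.
move=> c [_ cF]; rewrite (lubell_partition c).
have r0 : 0 < r := leq_ltn_trans (leq0n i0) (ltn_ord i0).
apply: (@le_trans _ _ (\sum_i (e (S i))%:R)%R).
  apply: ler_sum => i _.
  apply: (m_L_bounded_leq (leq_bigmax i) (mP i)); first exact: cF.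
  by move=> A /setIdP[/sF].
by rewrite -natr_sum ler_nat sum_e_le_osum.
Qed.

Theorem theorem6p2 (d : Order.disp_t) (k l : nat)
    (P : 'I_k -> marked_poset d) (Q : 'I_l -> marked_poset d) :
  ~ (k = 0 /\ l = 0) ->
  (forall i : 'I_k, L_bounded (P i)) ->
  (forall j : 'I_l, L_bounded (Q j)) ->
  (forall i : 'I_k, large_interval (lo (P i)) (hi (P i))) ->
  (forall j : 'I_l, large_interval (lo (Q j)) (hi (Q j))) ->
  (forall i : 'I_k, has_zero (P i)) ->
  (forall j : 'I_l, has_one (Q j)) ->
  L_bounded (osum (ffcat Q P)).
Proof.
move=> kl bP bQ IP IQ zP oQ.
(* The pivot is the last [Q], or, when [l = 0], the first [P] by truncation. In both cases all later
   summands are among the [P] and all earlier ones among the [Q]. *)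
have lt_i0 : l.-1 < l + k by lia.
apply: (@osum_L_bounded _ _ _ (Ordinal lt_i0)) => i; rewrite /ffcat.
- by case: splitP.
- by case: splitP.
- by case: splitP => // j /= ->; have := ltn_ord j; lia.
- by case: splitP => // j /= ->; lia.
Qed.
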